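(* Let $T$ be a tree on $n\ge4$ vertices, let $v_1$ and $v_c$ be two non-adjacent vertices of $T$, let $v_1,v_2,\dots,v_c$ be the unique path in $T$ from $v_1$ to $v_c$ (so $c\ge3$), and let $G$ be the graph obtained from $T$ by adding the edge $v_1v_c$. Then $$\begin{aligned}\mathcal{K}(G)-\mathcal{K}(T)\ge\frac{1}{4cn(n-1)}\Big\{&-\tfrac{2}{3}(n+1)c^2(c^2-1)-8(n-c)\Big(-nc^2+\tfrac{c(c+1)}{6}\big((2n+1)c+n-1\big)\Big)\\&-8\left\lfloor\tfrac{n-c}{2}\right\rfloor\left\lceil\tfrac{n-c}{2}\right\rceil\big((n-1)(c-1)^2+c(c-1)\big)+4n(n-1)c(c-1)+2(n-1)c^2\Big\},\end{aligned}$$ with equality if and only if $T$ is formed from the path $v_1,v_2,\dots,v_c$ by appending $\lfloor\frac{n-c}{2}\rfloor$ pendent vertices at one of its end points and $\lceil\frac{n-c}{2}\rceil$ pendent vertices at the other end point.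
   Context: Kemeny's constant: for a connected graph $H$ with adjacency matrix $A$ and diagonal degree matrix $\Delta$, consider the random walk with transition matrix $\Delta^{-1}A$, its stationary distribution $w=(w_k)$ and mean first passage times $m_{j,k}$; then $\mathcal{K}(H)=\sum_{k\neq j} m_{j,k}w_k$, which is independent of $j$. *)

(* Defs.v *)
From HB Require Import structures.
From mathcomp Require Import all_boot all_order all_algebra.
From mathcomp Require Import all_classical all_reals all_analysis.
Set Implicit Arguments. Unset Strict Implicit. Unset Printing Implicit Defensive.
Import Order.TTheory GRing.Theory Num.Theory.
Import numFieldNormedType.Exports.
Local Open Scope ring_scope.

Section Kemeny.
Variables (R : realType) (V : finType).

Definition simple_graph (e : rel V) : Prop := symmetric e /\ irreflexive e.

Definition connected_graph (e : rel V) : Prop := forall u v : V, connect e u v.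

Definition is_tree (e : rel V) : Prop :=
  connected_graph e /\ ~ (exists cy : seq V, [/\ uniq cy, 3 <= size cy & cycle e cy]%N).

Definition path_between (e : rel V) (x y : V) (s : seq V) : Prop :=
  exists t : seq V, [/\ s = x :: t, path e x t, last x t = y & uniq s].

Definition add_edge (e : rel V) (x y : V) : rel V :=
  fun u v => [|| e u v, (u == x) && (v == y) | (u == y) && (v == x)].

Definition deg (e : rel V) (v : V) : nat := #|[set u | e v u]|.

Definition trans (e : rel V) (j k : V) : R := (e j k)%:R / (deg e j)%:R.

Fixpoint first_passage (e : rel V) (t : nat) (j k : V) : R :=
  match t with
  | 0 => 0
  | 1 => trans e j k
  | t'.+1 => \sum_(l | l != k) trans e j l * first_passage e t' l k
  end.

Definition mfpt (e : rel V) (j k : V) : R :=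
  limn (series (fun t : nat => t%:R * first_passage e t j k)).

Definition stationary (e : rel V) (w : V -> R) : Prop :=
  [/\ forall k, 0 <= w k, \sum_k w k = 1 & forall k, \sum_j w j * trans e j k = w k].

Definition kemeny (e : rel V) (w : V -> R) (j : V) : R :=
  \sum_(k | k != j) mfpt e j k * w k.

Definition bound41 (n c : nat) : R :=
  let N := n%:R in let C := c%:R in
  let fl := ((n - c)./2)%:R in let ce := (uphalf (n - c))%:R in
  (4 * C * N * (N - 1))^-1 *
  ( - (2 / 3) * (N + 1) * C ^+ 2 * (C ^+ 2 - 1)
    - 8 * (N - C) * (- N * C ^+ 2 + C * (C + 1) / 6 * ((2 * N + 1) * C + N - 1))
    - 8 * fl * ce * ((N - 1) * (C - 1) ^+ 2 + C * (C - 1))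
    + 4 * N * (N - 1) * C * (C - 1) + 2 * (N - 1) * C ^+ 2).

Definition pendent_at_ends (e : rel V) (s : seq V) (x y : V) (a b : nat) : Prop :=
  [/\ forall u, u \notin s -> deg e u = 1%N /\ (e u x || e u y),
      #|[set u | e x u & u \notin s]| = a
    & #|[set u | e y u & u \notin s]| = b].

End Kemeny.

(* Main.v *)
(* Let m be the number of edges of a connected graph.  If D is a function for
   which the Laplacian of D(., z) at x is a(x) - 2 [x = z] (an effective
   resistance), then the mean first passage time from j to k is
   1/2 sum_z deg z (D j k + D k z - D j z), so Kemeny's constant is
   1/(4m) sum_{u,v} deg u deg v D u v.  In a tree D is the distance d, and adding
   the edge between the ends of a path with c vertices turns D into
   d(u,v) - (p u - p v)^2 / c, where p u is the position of the projection of u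
   on the path; write t u for the distance from u to the path.
   Discrete integration by parts removes the degrees, and, with n the number of
   vertices and B the set of vertices off the path, 4cn(n-1) times the difference
   between the two sides of the inequality becomes a sum of three nonnegative
   terms:
     4c sum_{u <> v} (t u + t v + |p u - p v| - d(u,v)),
     8cn sum_{u in B} p u (c - 1 - p u), and
     4 (2 fl ce g(c-1) - sum_{u,v in B} g |p u - p v|),  g k = c k + (n-1) k^2,
   where fl and ce are the floor and the ceiling of |B|/2.  The first term is
   nonnegative by the four-point condition, the last by counting the pairs
   separated by each edge of the path.  All three vanish exactly when every
   vertex of B is pendent at an end of the path and B is split evenly. *)

Require Import Defs.
From HB Require Import structures.
From mathcomp Require Import all_boot all_order all_algebra.
From mathcomp Require Import all_classical all_reals all_analysis.
From mathcomp Require Import ring lra zify.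
Set Implicit Arguments.
Unset Strict Implicit.
Unset Printing Implicit Defensive.
Import Order.TTheory GRing.Theory Num.Theory.
Import numFieldNormedType.Exports.
Local Open Scope ring_scope.

(** * Mean first passage times and Kemeny's constant *)

(** [1 - x ^+ n] is [1 - x] times a geometric sum whose [n] terms are each at least [x ^+ n]. *)
Lemma natmul_geometric_bound (R : realFieldType) (x : R) (n : nat) :
  0 <= x <= 1 -> n%:R * x ^+ n * (1 - x) <= 1.
Proof.
move=> /andP[x0 x1].
suff: n%:R * x ^+ n * (1 - x) <= 1 - x ^+ n.
  by move/le_trans; apply; rewrite gerBl exprn_ge0.
have -> : 1 - x ^+ n = (1 - x) * \sum_(i < n) x ^+ i.
  have := subrXX 1 x n; rewrite expr1n => ->; congr (_ * _).
  by apply: eq_bigr => i _; rewrite expr1n mul1r.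
rewrite mulrC ler_wpM2l ?subr_ge0//.
have -> : n%:R * x ^+ n = \sum_(i < n) x ^+ n.
  by rewrite sumr_const card_ord mulr_natl.
apply: ler_sum => i _; apply: ler_wiXn2l => //; exact: ltnW.
Qed.

(** With [y] the square root of [x], the bound above absorbs [n] into one factor [y ^+ n] and leaves
    the other to decay. *)
Lemma cvg_natmul_geometric (R : realType) (x : R) : 0 <= x < 1 ->
  ((fun n : nat => n%:R * x ^+ n) @ \oo --> (0 : R))%classic.
Proof.
move=> /andP[x0 x1].
pose y := Num.sqrt x.
have y0 : 0 <= y by exact: sqrtr_ge0.
have y1 : y < 1 by rewrite -sqrtr1 ltr_sqrt.
have xy n : x ^+ n = y ^+ n * y ^+ n by rewrite -exprMn -expr2 sqr_sqrtr.
apply: (@squeeze_cvgr _ _ _ _ (fun=> 0) (fun n => (1 - y)^-1 * y ^+ n)).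
- near=> n; rewrite mulr_ge0 ?ler0n ?exprn_ge0//= xy mulrA ler_wpM2r ?exprn_ge0//.
  rewrite -[leRHS]mul1r ler_pdivlMr ?subr_gt0//.
  by apply: natmul_geometric_bound; rewrite y0 ltW.
- exact: cvg_cst.
- by apply: cvg_geometric; rewrite ger0_norm.
Unshelve. all: by end_near.
Qed.

Section HittingTimes.
Variables (R : realType) (V : finType) (e : rel V).
Hypothesis deg_gt0 : forall v, (0 < deg e v)%N.
Variable k : V.

Lemma sum_edge_deg (v : V) : \sum_l (e v l)%:R = (deg e v)%:R :> R.
Proof.
rewrite -natr_sum; congr (_%:R); rewrite /deg -sum1_card.
by rewrite [RHS]big_mkcond; apply: eq_bigr => l _; rewrite inE.
Qed.

Lemma trans_ge0 (j l : V) : 0 <= trans R e j l.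
Proof. by rewrite /trans mulr_ge0 ?invr_ge0. Qed.

Lemma sum_trans (j : V) : \sum_l trans R e j l = 1.
Proof.
by rewrite -mulr_suml sum_edge_deg mulfV// pnatr_eq0 -lt0n.
Qed.

Let step (f : V -> R) (j : V) : R := \sum_(l | l != k) trans R e j l * f l.

Let step_ge0 f : (forall j, 0 <= f j) -> forall j, 0 <= step f j.
Proof. by move=> f0 j; apply: sumr_ge0 => l _; rewrite mulr_ge0 ?trans_ge0. Qed.

Let step_le f g : (forall j, f j <= g j) -> forall j, step f j <= step g j.
Proof. by move=> fg j; apply: ler_sum => l _; rewrite ler_wpM2l ?trans_ge0. Qed.

Let iter_ge0 n f : (forall j, 0 <= f j) -> forall j, 0 <= iter n step f j.
Proof. by elim: n => [|n IH] f0 j //=; apply: step_ge0; apply: IH. Qed.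

(* [survival t j] is the probability that the walk from [j] avoids [k] at times 1, ..., t. *)
Let survival t : V -> R := iter t step (fun=> 1).

Let first_passage_survival t j :
  first_passage R e t.+1 j k = survival t j - survival t.+1 j.
Proof.
elim: t j => [|t IH] j.
  rewrite /survival /= /step (eq_bigr (trans R e j)) => [|l _]; last exact: mulr1.
  by have := sum_trans j; rewrite (bigD1 k)//= => <-; rewrite addrK.
have -> : first_passage R e t.+2 j k =
    \sum_(l | l != k) trans R e j l * first_passage R e t.+1 l k by [].
rewrite (eq_bigr _ (fun l _ => congr1 _ (IH l))).
rewrite /survival [iter t.+2 _ _]iterS [in RHS]iterS /step -sumrB.
by apply: eq_bigr => l _; rewrite mulrBr.
Qed.

(** Abel summation against the survival probabilities. *)
Let sum_first_passage N j :
  \sum_(0 <= t < N.+1) t%:R * first_passage R e t j k =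
  \sum_(0 <= t < N) survival t j - N%:R * survival N j.
Proof.
elim: N => [|N IH]; first by rewrite big_nat1 big_geq// mul0r mul0r subr0.
rewrite big_nat_recr// IH first_passage_survival [in RHS]big_nat_recr//=.
by rewrite -addn1 natrD; ring.
Qed.

(** As [h] is at least 1 and at most [C], one step multiplies it by at most [1 - C^-1]; this forces
    geometric decay, and the survival probabilities sum to [h]. At [k] itself the equation gives the
    mean return time. *)
Lemma mfpt_unique (h : V -> R) (j : V) :
    (forall l, 0 <= h l) ->
    (forall l, h l = 1 + \sum_(l' | l' != k) trans R e l l' * h l') ->
  mfpt R e j k = h j.
Proof.
move=> h0 hE.
have hS l : h l = 1 + step h l by exact: hE.
have h1 l : 1 <= h l by rewrite hS lerDl step_ge0.
pose C := \sum_l h l.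
have hC l : h l <= C by rewrite /C (bigD1 l)//= lerDl sumr_ge0.
have C1 : 1 <= C by exact: le_trans (h1 j) (hC j).
have C0 : 0 < C by exact: lt_le_trans ltr01 C1.
pose r := 1 - C^-1.
have r0 : 0 <= r by rewrite subr_ge0 invf_le1.
have r1 : r < 1 by rewrite gtrBl invr_gt0.
have step_h l : step h l <= r * h l.
  have -> : step h l = h l - 1 by rewrite [in RHS]hS addrC addKr.
  rewrite mulrBl mul1r lerB// mulrC ler_pdivrMr// mul1r; exact: hC.
have iter_h n l : iter n step h l <= r ^+ n * h l.
  elim: n l => [|n IH] l; first by rewrite mul1r.
  rewrite iterS; apply: le_trans (step_le IH _) _.
  have -> : step (fun j => r ^+ n * h j) l = r ^+ n * step h l.
    by rewrite /step mulr_sumr; apply: eq_bigr => i _; ring.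
  by rewrite exprSr -mulrA ler_wpM2l ?exprn_ge0.
have surv_h n l : survival n l <= iter n step h l.
  by elim: n l => [|n IH] l //=; apply: step_le.
have sum_surv n l : \sum_(0 <= t < n) survival t l = h l - iter n step h l.
  elim: n l => [|n IH] l; first by rewrite big_geq// subrr.
  rewrite big_nat_recr//= IH.
  suff -> : iter n step h l = survival n l + step (iter n step h) l by ring.
  elim: n l {IH} => [|n IH] l; first exact: hS.
  rewrite /survival !iterS {1}/step (eq_bigr _ (fun i _ => congr1 _ (IH i))).
  by rewrite -big_split; apply: eq_bigr => i _; rewrite mulrDr.
(* The partial sums fall short of [h j] by a tail and a boundary term, bounded by [C * r ^+ n] and
   [n] times that. *)
rewrite /mfpt; apply: cvg_lim => //; rewrite -cvg_shiftS /=.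
apply: (@squeeze_cvgr _ _ _ _
  (fun n => h j - (C * r ^+ n + C * (n%:R * r ^+ n))) (fun=> h j)).
- near=> n; rewrite /series/= sum_first_passage sum_surv -addrA -opprD.
  have i0 : 0 <= iter n step h j by exact: iter_ge0.
  have s0 : 0 <= n%:R * survival n j.
    by rewrite mulr_ge0//; apply: iter_ge0 => i.
  have iC : iter n step h j <= C * r ^+ n.
    by apply: le_trans (iter_h _ _) _; rewrite mulrC ler_wpM2r ?exprn_ge0.
  apply/andP; split; last by rewrite gerBl addr_ge0.
  rewrite lerB// lerD// mulrCA ler_wpM2l//.
  exact: le_trans (surv_h _ _) iC.
- rewrite -[X in (_ --> X)%classic]subr0; apply: cvgB; first exact: cvg_cst.
  rewrite -[X in (_ --> X)%classic]addr0; apply: cvgD.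
    by apply: cvg_geometric; rewrite ger0_norm.
  rewrite -(mulr0 C); apply: cvgMr; apply: cvg_natmul_geometric.
  by rewrite r0 r1.
- exact: cvg_cst.
Unshelve. all: by end_near.
Qed.

End HittingTimes.

(** * Laplacian, effective resistance and Kemeny's constant *)

Section Resistance.
Variables (R : realType) (V : finType) (e : rel V).
Hypothesis e_sym : symmetric e.
Hypothesis e_conn : connected_graph e.
Hypothesis deg_gt0 : forall v, (0 < deg e v)%N.

Definition lap (f : V -> R) (j : V) : R := \sum_l (e j l)%:R * (f j - f l).

Lemma lapE f j : lap f j = (deg e j)%:R * f j - \sum_l (e j l)%:R * f l.
Proof.
rewrite -(sum_edge_deg R e j) mulr_suml -sumrB.
by apply: eq_bigr => l _; rewrite mulrBr.
Qed.

(** Symmetry of [e] makes the Laplacian self-adjoint: discrete integration by parts. *)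
Lemma sum_lapM f g : \sum_j lap f j * g j = \sum_j f j * lap g j.
Proof.
transitivity (\sum_j (deg e j)%:R * f j * g j - \sum_j \sum_l (e j l)%:R * f l * g j).
  rewrite -sumrB; apply: eq_bigr => j _.
  by rewrite lapE mulrBl; congr (_ - _); rewrite mulr_suml.
rewrite exchange_big -sumrB; apply: eq_bigr => j _ /=.
rewrite lapE mulrBr; congr (_ - _); first by rewrite mulrCA mulrA.
by rewrite mulr_sumr; apply: eq_bigr => l _; rewrite e_sym mulrCA mulrA.
Qed.

Lemma minimum_attained (f : V -> R) (k : V) : exists m, forall v, f m <= f v.
Proof. by case: (@arg_minP _ _ _ k xpredT f isT) => m _ Hm; exists m => v; apply: Hm. Qed.

Lemma lap_min_le0 f m : (forall v, f m <= f v) -> lap f m <= 0.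
Proof.
move=> fm; rewrite -oppr_ge0 -sumrN; apply: sumr_ge0 => l _.
by rewrite -mulrN mulr_ge0// opprB subr_ge0.
Qed.

(** Minimum principle: the neighbours of a minimum share its value, and connectedness spreads it. *)
Lemma lap0_constant f : (forall j, lap f j = 0) -> forall u v, f u = f v.
Proof.
move=> f0 u v; have [m fm] := minimum_attained f u.
suff fE w : f w = f m by rewrite !fE.
have /connectP[p] := e_conn m w.
elim/last_ind: p w => [|p x IH] w /=; first by move=> _ ->.
rewrite rcons_path last_rcons => /andP[pp ex] ->.
have {IH pp}fl := IH _ pp erefl.
have /eqP := f0 (last m p); rewrite /lap.
have -> : \sum_l (e (last m p) l)%:R * (f (last m p) - f l) =
   - \sum_l (e (last m p) l)%:R * (f l - f m).
  by rewrite -sumrN; apply: eq_bigr => l _; rewrite fl -mulrN opprB.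
rewrite oppr_eq0 psumr_eq0 => [/allP/(_ x)|l _]; last by rewrite mulr_ge0// subr_ge0.
by rewrite mem_index_enum ex mul1r subr_eq0 => /(_ isT)/eqP.
Qed.

(** By symmetry of [e] the quotient [w v / deg e v] is harmonic, hence constant; the total mass
    fixes it. *)
Lemma stationaryE (w : V -> R) (j : V) : stationary e w ->
  w j = (deg e j)%:R / \sum_v (deg e v)%:R.
Proof.
move=> [w0 w1 wP].
have dR v : (deg e v)%:R != 0 :> R by rewrite pnatr_eq0 -lt0n.
pose u v := w v / (deg e v)%:R.
have wu v : w v = (deg e v)%:R * u v by rewrite /u mulrCA divff// mulr1.
have lu v : lap u v = 0.
  rewrite lapE -wu -(wP v) -sumrB big1// => l _.
  by rewrite /trans /u e_sym; ring.
have uE v : u v = u j by exact: lap0_constant.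
have : \sum_v (deg e v)%:R * u j = 1.
  by rewrite -[RHS]w1; apply: eq_bigr => v _; rewrite wu (uE v).
rewrite -mulr_suml => H; rewrite wu; congr (_ * _).
have S0 : \sum_v (deg e v)%:R != 0 :> R.
  by apply/eqP => S0; move: H; rewrite S0 mul0r => /esym/eqP; rewrite oner_eq0.
by rewrite -[LHS](mulKf S0) H mulr1.
Qed.

Variables (D : V -> V -> R) (a : V -> R).
Hypothesis D0 : forall k, D k k = 0.
Hypothesis lapD : forall x z, lap (D^~ z) x = a x - 2 * (x == z)%:R.

(** In the Laplacian of the right-hand side at [i != k] the terms [a i] cancel and only [z = i]
    survives, leaving [deg e i]: this is the hitting-time equation times the degree. *)
Lemma mfpt_resistance (j k : V) : j != k ->
  mfpt R e j k = 2^-1 * \sum_z (deg e z)%:R * (D j k + D k z - D j z).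
Proof.
move=> jk.
pose h i := 2^-1 * \sum_z (deg e z)%:R * (D i k + D k z - D i z).
have hk : h k = 0.
  by rewrite /h big1 ?mulr0// => z _; rewrite D0 add0r subrr mulr0.
have lh i : i != k -> lap h i = (deg e i)%:R.
  move=> ik.
  have -> : lap h i = 2^-1 * \sum_z (deg e z)%:R * (lap (D^~ k) i - lap (D^~ z) i).
    rewrite /lap mulr_sumr; under [RHS]eq_bigr do rewrite -sumrB mulrCA !mulr_sumr.
    rewrite exchange_big; apply: eq_bigr => l _ /=.
    rewrite /h -mulrBr -sumrB !mulr_sumr; apply: eq_bigr => z _; ring.
  rewrite (bigD1 i)//= big1 => [|z zi].
    by rewrite !lapD eqxx (negbTE ik) mulr0n mulr1n; field.
  by rewrite !lapD (negbTE ik) eq_sym (negbTE zi) subrr mulr0.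
(* A minimum away from [k] would have positive Laplacian, which is impossible, so the minimum is
   [h k = 0]. *)
have hge0 i : 0 <= h i.
  have [m Hm] := minimum_attained h k.
  have [mk|mk] := eqVneq m k; first by rewrite -hk -mk.
  have := lap_min_le0 Hm; rewrite lh// => dm.
  by have := deg_gt0 m; rewrite -(ltr0n R) ltNge dm.
(* [h] vanishes at [k], where [mfpt_unique] asks for the mean return time. *)
pose h' i := if i == k then 1 + \sum_(l | l != k) trans R e i l * h l else h i.
have sumh' i : \sum_(l | l != k) trans R e i l * h' l =
    \sum_(l | l != k) trans R e i l * h l.
  by apply: eq_bigr => l lk; rewrite /h' (negbTE lk).
rewrite (@mfpt_unique _ _ _ deg_gt0 k h') => [||i].
- by rewrite /h' (negbTE jk).
- move=> i; rewrite /h'; case: eqP => // _; apply: addr_ge0 => //.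
  by apply: sumr_ge0 => l _; rewrite mulr_ge0 ?trans_ge0.
rewrite sumh' {1}/h'; case: eqP => // /eqP ik.
have d0 : (deg e i)%:R != 0 :> R by rewrite pnatr_eq0 -lt0n.
apply: (mulfI d0); have := lh i ik; rewrite lapE => /eqP.
rewrite subr_eq => /eqP ->; rewrite mulrDr mulr1; congr (_ + _).
rewrite (bigD1 k)//= hk mulr0 add0r mulr_sumr; apply: eq_bigr => l _.
by rewrite /trans; field.
Qed.

(* The Tetali formula for hitting times, averaged against the stationary
   distribution, loses its dependence on the starting point. *)
Lemma kemeny_resistance (w : V -> R) (j : V) : stationary e w ->
  kemeny e w j = (2 * \sum_v (deg e v)%:R)^-1 *
    \sum_u \sum_v (deg e u)%:R * (deg e v)%:R * D u v.
Proof.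
move=> st; rewrite /kemeny.
set S := \sum_v _.
have -> : \sum_(k | k != j) mfpt R e j k * w k =
   \sum_k (2 * S)^-1 * \sum_z (deg e k)%:R * (deg e z)%:R * (D j k + D k z - D j z).
  rewrite [RHS](bigD1 j)//= [X in _ = _ * X + _]big1 ?mulr0 ?add0r => [|z _]; last first.
    by rewrite D0 add0r subrr mulr0.
  apply: eq_bigr => k kj.
  rewrite mfpt_resistance 1?eq_sym// (stationaryE _ st) -/S invfM !mulr_sumr mulr_suml.
  by apply: eq_bigr => z _; ring.
rewrite -mulr_sumr; congr (_ * _).
transitivity (\sum_k \sum_z (deg e k)%:R * (deg e z)%:R * D k z +
  (\sum_k \sum_z (deg e k)%:R * (deg e z)%:R * D j k -
  \sum_k \sum_z (deg e k)%:R * (deg e z)%:R * D j z)).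
  rewrite -sumrB -big_split; apply: eq_bigr => k _ /=.
  by rewrite -sumrB -big_split; apply: eq_bigr => z _ /=; ring.
rewrite [X in X - _]exchange_big /=.
suff -> : \sum_i \sum_k (deg e k)%:R * (deg e i)%:R * D j k =
  \sum_k \sum_z (deg e k)%:R * (deg e z)%:R * D j z by rewrite subrr addr0.
rewrite exchange_big /= exchange_big; apply: eq_bigr => k _ /=.
by apply: eq_bigr => z _; rewrite [X in X * _]mulrC.
Qed.

End Resistance.

(** * The metric of a tree *)

Section TreeMetric.
Local Open Scope nat_scope.
Variables (V : finType) (e : rel V).

Definition graph_distance (d : V -> V -> nat) : Prop :=
  (forall u v, exists p, [/\ path e u p, last u p = v & size p = d u v]) /\
  (forall u p, path e u p -> d u (last u p) <= size p).

Lemma exists_graph_distance : connected_graph e -> exists d, graph_distance d.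
Proof.
move=> conn.
have ex (uv : V * V) : {n | (exists p, [/\ path e uv.1 p, last uv.1 p = uv.2 & size p = n])
    /\ forall p, path e uv.1 p -> last uv.1 p = uv.2 -> n <= size p}.
  case: uv => u v; apply: cid => /=.
  pose P n := `[< exists p, [/\ path e u p, last u p = v & size p = n] >].
  have exP : exists n, P n.
    have /connectP[p pp pv] := conn u v.
    by exists (size p); apply/asboolP; exists p.
  case: (ex_minnP exP) => n /asboolP Hn minn; exists n; split => // p pp pv.
  by apply: minn; apply/asboolP; exists p.
exists (fun u v => sval (ex (u, v))); split => [u v|u p pp].
  by case: (ex (u, v)) => n [].
by case: (ex _) => n [_] /= ->.
Qed.

Hypothesis e_sym : symmetric e.
Hypothesis e_irr : irreflexive e.
Hypothesis acyclic : ~ (exists cy : seq V, [/\ uniq cy, 3 <= size cy & cycle e cy]).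
Variable d : V -> V -> nat.
Hypothesis dP : graph_distance d.

Lemma dist_le u p : path e u p -> d u (last u p) <= size p.
Proof. exact: (proj2 dP). Qed.

Lemma dist_geodesic u v : exists p, [/\ path e u p, last u p = v & size p = d u v].
Proof. exact: (proj1 dP). Qed.

Lemma dist_refl u : d u u = 0.
Proof. by apply/eqP; rewrite -leqn0; exact: (@dist_le u [::]). Qed.

Lemma dist0_eq u v : d u v = 0 -> u = v.
Proof. by have [[|x p] [_ <- <-]] := dist_geodesic u v. Qed.

Lemma dist_gt0 u v : u != v -> 0 < d u v.
Proof. by rewrite lt0n; apply: contra => /eqP/dist0_eq/eqP. Qed.

Lemma dist_triangle w u v : d u v <= d u w + d w v.
Proof.
have [p [pp pw <-]] := dist_geodesic u w; have [q [qq qv <-]] := dist_geodesic w v.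
rewrite -size_cat; have -> : v = last u (p ++ q) by rewrite last_cat pw.
by apply: dist_le; rewrite cat_path pp pw.
Qed.

Lemma dist_sym u v : d u v = d v u.
Proof.
suff le x y : d x y <= d y x by apply/eqP; rewrite eqn_leq !le.
have [p [pp px <-]] := dist_geodesic y x.
have -> : y = last x (rev (belast y p)).
  by rewrite -px; case: p {pp px} => //= a p; rewrite rev_cons last_rcons.
apply: leq_trans (dist_le _) _; last by rewrite size_rev size_belast.
by rewrite -px rev_path (eq_path (e' := e)) // => a b; rewrite e_sym.
Qed.

Lemma dist_edge u v : e u v -> d u v = 1.
Proof.
move=> euv; apply/eqP; rewrite eqn_leq dist_gt0 ?andbT; last first.
  by apply: contraTneq euv => ->; rewrite e_irr.
by apply: (@dist_le u [:: v]); rewrite /= euv.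
Qed.

Lemma dist1_edge u v : d u v = 1 -> e u v.
Proof.
by have [[|x [|y p]] [/= + <- <-]] := dist_geodesic u v => // /andP[].
Qed.

Lemma dist_step u l z : e u l -> d u z <= (d l z).+1.
Proof. by move=> /dist_edge eul; apply: leq_trans (dist_triangle l _ _) _; rewrite eul. Qed.

Lemma parent_exists u z : u != z -> exists2 l, e u l & d u z = (d l z).+1.
Proof.
have [[|l p] [/= + + sz]] := dist_geodesic u z; first by move=> _ -> /eqP.
move=> /andP[eul pp] pz _; exists l => //; apply/eqP.
by rewrite eqn_leq dist_step// -sz -pz ltnS dist_le.
Qed.

(* A walk between two neighbours of [u] that avoids [u] would close a cycle. *)
Let avoid u : rel V := fun v w => [&& e v w, v != u & w != u].

Lemma no_detour u a b : e u a -> e u b -> connect (avoid u) a b -> a = b.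
Proof.
move=> ua ub /connectP[p pp pb]; apply/eqP; apply/negPn/negP => ab.
case/shortenP: pp pb => q qq uq _ qb.
case: acyclic; exists (u :: a :: q).
have notin x : path (avoid u) x q -> u \notin q.
  elim: q x {uq qq qb} => //= y q IH x /andP[/and3P[_ _ yu] /IH]; rewrite inE negb_or => ->.
  by rewrite eq_sym yu.
split.
- rewrite cons_uniq uq andbT inE negb_or (notin _ qq) andbT.
  by apply: contraTneq ua => ->; rewrite e_irr.
- by case: q qb {uq qq notin} => //= ba; rewrite ba eqxx in ab.
- rewrite /= rcons_path ua -qb e_sym ub andbT /=.
  by apply: sub_path qq => x y /and3P[].
Qed.

(** Parents lead from [a] to [z]; after the first step they are nearer to [z] than [u] is, so the
    walk misses [u]. *)
Let avoid_descend u a z : a != u -> d a z <= d u z -> connect (avoid u) a z.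
Proof.
move En : (d a z) => n; elim: n a En => [|n IH] a En au le.
  by rewrite (dist0_eq En) connect0.
have az : a != z by apply/eqP => az; rewrite az dist_refl in En.
have [l al dl] := parent_exists az.
have dln : d l z = n by move: dl; rewrite En => -[].
have lu : l != u by apply: contraTneq le => <-; rewrite dln ltnn.
apply: connect_trans (IH l dln lu (ltnW le)).
by apply: connect1; rewrite /avoid al au lu.
Qed.

(** Both neighbours reach [z] without meeting [u], so [no_detour] applies. Allowing equality lets
    [dist_adj] exclude equidistant neighbours. *)
Lemma parent_unique u a b z : e u a -> e u b -> d a z <= d u z -> d b z <= d u z -> a = b.
Proof.
move=> ua ub da db; apply: (no_detour ua ub).
have nbr w : e u w -> w != u by apply: contraTneq => ->; rewrite e_irr.
have csym : connect_sym (avoid u).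
  by apply: sym_connect_sym => v w; rewrite /avoid e_sym; congr (_ && _); rewrite andbC.
apply: connect_trans (avoid_descend (nbr _ ua) da) _.
by rewrite csym; exact: avoid_descend (nbr _ ub) db.
Qed.

Lemma dist_adj u l z : e u l -> d l z = (d u z).+1 \/ d u z = (d l z).+1.
Proof.
move=> ul; case: (ltnP (d u z) (d l z)) => [lt|le].
  by left; apply/eqP; rewrite eqn_leq lt andbT dist_step// e_sym.
have [uz|uz] := eqVneq u z.
  have lz : l = z by apply: dist0_eq; apply/eqP; rewrite -leqn0 (leq_trans le)// uz dist_refl.
  by move: ul; rewrite uz lz e_irr.
have [a ua da] := parent_exists uz; right.
by rewrite -(parent_unique ua ul _ le)// da ltnW.
Qed.

(** Induction along the geodesic from [u] to [x]: its next vertex [b] is not [l], the only neighbour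
    of [u] nearer to [v], so [b] is again farther from [v]. *)
Lemma dist_through u l v x : e u l -> d u v = (d l v).+1 -> d l x = (d u x).+1 ->
  d v x = d v u + d u x.
Proof.
move En : (d u x) => n; elim: n u l En => [|n IH] u l En ul uv lx.
  by rewrite (dist0_eq En) addn0.
have ux : u != x by apply/eqP => ux; rewrite ux dist_refl in En.
have [b ub db] := parent_exists ux.
have dbn : d b x = n by move: db; rewrite En => -[].
have bv : d b v = (d u v).+1.
  case: (dist_adj v ub) => // bv; exfalso.
  have bl : b = l by apply: (@parent_unique u b l v) => //; lia.
  by move: lx; rewrite -bl dbn; lia.
have bu : e b u by rewrite e_sym.
by rewrite (IH b u dbn bu bv En) [d v b]dist_sym bv dist_sym; lia.
Qed.

(** [u] moves to its parent [l] towards [v]. If [l] is farther than [u] from [x] or from [y], then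
    [u] lies between [v] and that vertex and the triangle inequality suffices; otherwise both sides
    drop by one. *)
Lemma four_point u v x y :
  d u v + d x y <= maxn (d u x + d v y) (d u y + d v x).
Proof.
move En : (d u v) => n; elim: n u En => [|n IH] u En.
  rewrite (dist0_eq En); have := dist_triangle v x y; rewrite (dist_sym x v); lia.
have uv : u != v by apply/eqP => uv; rewrite uv dist_refl in En.
have [l ul dl] := parent_exists uv.
have dln : d l v = n by move: dl; rewrite En => -[].
have := IH l dln.
have := dist_triangle u x y; have := dist_triangle u y x.
rewrite (dist_sym x u) (dist_sym y u) (dist_sym y x).
have duv := dist_sym v u.
case: (dist_adj x ul) => [lx|lx].
  have := dist_through ul dl lx; lia.
case: (dist_adj y ul) => [ly|ly]; last by lia.
have := dist_through ul dl ly; lia.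
Qed.

(** * Distances along a simple path of the tree *)

Section Path.
Variables (x : V) (t : seq V).
Hypotheses (tP : path e x t) (tU : uniq (x :: t)).
Let s := x :: t.
Let y := last x t.

Let edge_nth i : i < size t -> e (nth x s i) (nth x s i.+1).
Proof. by move=> it; have /(pathP x)/(_ i it) := tP. Qed.

Lemma dist_path_start i : i < size s -> d (nth x s i) x = i.
Proof.
(* Two consecutive indices are carried: a drop in distance after [i.+1] would make the vertices at
   [i] and [i.+2] both parents of the one between, hence equal. *)
have: (i < size s -> d (nth x s i) x = i) /\ (i.+1 < size s -> d (nth x s i.+1) x = i.+1).
  elim: i => [|i [IH IH1]].
    split; first by rewrite dist_refl.
    by move=> it; rewrite dist_sym dist_edge//; exact: (@edge_nth 0).
  split => // it; have it' := ltnW it; have it'' := ltnW it'.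
  case: (dist_adj x (@edge_nth i.+1 it)) => [->|]; first by rewrite IH1.
  rewrite (IH1 it') => -[di].
  have ss : nth x s i = nth x s i.+2.
    apply: (@parent_unique (nth x s i.+1) _ _ x); rewrite ?IH1 ?IH -?di//.
      by rewrite e_sym; exact: edge_nth.
    exact: edge_nth.
  by move/eqP: ss; rewrite nth_uniq//; lia.
by case.
Qed.

Lemma dist_path_ends : d x y = size t.
Proof.
by rewrite dist_sym -(@dist_path_start (size t))// nth_last.
Qed.

Lemma dist_path_end i : i < size s -> d (nth x s i) y = size t - i.
Proof.
move=> it.
have le k : i + k < size s -> d (nth x s i) (nth x s (i + k)) <= k.
  elim: k => [|k IH] ik; first by rewrite addn0 dist_refl.
  rewrite addnS in ik *; have := dist_triangle (nth x s (i + k)) (nth x s i) (nth x s (i + k).+1).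
  rewrite (dist_edge (edge_nth _))//; have := IH (ltnW ik); lia.
have := dist_triangle (nth x s i) x y; rewrite dist_path_ends (dist_sym x) dist_path_start//.
have := le (size t - i); rewrite subnKC// => /(_ (leqnn _)).
have -> : nth x s (size t) = y by rewrite (nth_last x s).
lia.
Qed.

(** The parent of [u] towards [x] is on the path by induction, and its unique neighbour nearer to
    [y] is the next path vertex. *)
Lemma geodesic_nth u : d u x + d u y = size t -> u = nth x s (d u x).
Proof.
move En : (d u x) => n; elim: n u En => [|n IH] u En uy.
  by rewrite (dist0_eq En).
have ux : u != x by apply/eqP => ux; rewrite ux dist_refl in En.
have [l ul dl] := parent_exists ux.
have dln : d l x = n by move: dl; rewrite En => -[].
have nt : n < size t by lia.
have ly : d l y = (d u y).+1.
  have := dist_triangle l x y; rewrite dist_path_ends (dist_sym x) dln.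
  have := dist_step y ul; have lu : e l u by rewrite e_sym.
  have := dist_step y lu; lia.
have ls : l = nth x s n by apply: IH => //; lia.
apply: (@parent_unique l _ _ y); first by rewrite e_sym.
- by rewrite ls; exact: edge_nth.
- by rewrite ly.
by rewrite ls !dist_path_end//=; [lia | exact: ltnW].
Qed.

End Path.
End TreeMetric.

(** * Sums of gaps *)

Definition gap (a b : nat) : nat := ((a - b) + (b - a))%N.

Lemma gapC a b : gap a b = gap b a.
Proof. by rewrite /gap addnC. Qed.

Lemma gap_sqr (R : realType) a b : (gap a b)%:R ^+ 2 = (a%:R - b%:R) ^+ 2 :> R.
Proof.
rewrite /gap; case: (leqP a b) => [ab|/ltnW ab].
  by rewrite (eqP ab) add0n natrB//; ring.
by rewrite (eqP ab) addn0 natrB.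
Qed.

Lemma mul_le_half a b : (a * b <= (a + b)./2 * uphalf (a + b))%N.
Proof.
wlog ab : a b / (a <= b)%N => [H|].
  by case/orP: (leq_total a b) => [/H//|/H]; rewrite addnC mulnC.
by rewrite uphalf_half; have := odd_double_half (a + b); rewrite -muln2; nia.
Qed.

(** The two orders become the two ways to share the pendent vertices between the ends. *)
Lemma mul_eq_half a b : (a * b = (a + b)./2 * uphalf (a + b))%N ->
  (a = (a + b)./2 /\ b = uphalf (a + b)) \/ (a = uphalf (a + b) /\ b = (a + b)./2).
Proof.
wlog ab : a b / (a <= b)%N => [H|].
  case/orP: (leq_total a b) => [/H//|/H]; rewrite addnC mulnC => ba /ba; tauto.
rewrite uphalf_half; have := odd_double_half (a + b); rewrite -muln2 => h eq.
by left; nia.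
Qed.

(** Counting the thresholds between [b] and [a] lets gap sums be bounded one path edge at a time. *)
Lemma sub_sum_cut m a b : (a <= m)%N -> (a - b = \sum_(k < m) (b <= k < a))%N.
Proof.
elim: m => [|m IH] am; first by rewrite big_ord0; lia.
rewrite big_ord_recr /=; case: (leqP a m) => [am'|am']; first by rewrite -IH//; lia.
have -> : a = m.+1 by lia.
have -> : (\sum_(i < m) (b <= i < m.+1) = \sum_(i < m) (b <= i < m))%N.
  by apply: eq_bigr => i _; rewrite ltnS (ltnW (ltn_ord i)) ltn_ord.
suff: (m - b = \sum_(i < m) (b <= i < m))%N by lia.
clear; elim: m => [|m IH]; first by rewrite big_ord0.
rewrite big_ord_recr /=.
have -> : (\sum_(i < m) (b <= i < m.+1) = \sum_(i < m) (b <= i < m))%N.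
  by apply: eq_bigr => i _; rewrite ltnS (ltnW (ltn_ord i)) ltn_ord.
by rewrite -IH; lia.
Qed.

(* Each threshold [k] separates at most [#|A|./2 * uphalf #|A|] pairs. *)
Lemma sum_gap_le (V : finType) (A : {set V}) (f : V -> nat) (m : nat) :
    (forall u, f u <= m)%N ->
  (\sum_(u in A) \sum_(v in A) gap (f u) (f v) <= 2 * (m * (#|A|./2 * uphalf #|A|)))%N.
Proof.
move=> fm.
suff H : (\sum_(u in A) \sum_(v in A) (f u - f v) <= m * (#|A|./2 * uphalf #|A|))%N.
  have -> : (\sum_(u in A) \sum_(v in A) gap (f u) (f v) =
    \sum_(u in A) \sum_(v in A) (f u - f v) + \sum_(u in A) \sum_(v in A) (f v - f u))%N.
    by rewrite -big_split; apply: eq_bigr => u _; rewrite -big_split.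
  by rewrite [X in (_ + X)%N]exchange_big mul2n -addnn leq_add.
under eq_bigr do under eq_bigr do rewrite (sub_sum_cut _ (fm _)).
under eq_bigr do rewrite exchange_big.
rewrite exchange_big /=.
suff H (k : 'I_m) : (\sum_(u in A) \sum_(v in A) (f v <= k < f u) <= #|A|./2 * uphalf #|A|)%N.
  apply: leq_trans (leq_sum _ (fun k _ => H k)) _.
  by rewrite sum_nat_const card_ord.
pose a := (\sum_(u in A) (k < f u))%N; pose b := (\sum_(v in A) (f v <= k))%N.
have ab : (a + b = #|A|)%N.
  by rewrite -sum1_card -big_split; apply: eq_bigr => u _ /=; rewrite ltnNge; case: leqP.
rewrite -ab; apply: leq_trans (mul_le_half a b); rewrite big_distrlr /=.
by apply: leq_sum => u _; apply: leq_sum => v _; rewrite mulnC mulnb.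
Qed.

Section PowerSums.
Variable R : realType.

Lemma sum_ordE n : \sum_(i < n.+1) (i%:R : R) = n%:R * (n%:R + 1) / 2.
Proof.
elim: n => [|n IH]; first by rewrite big_ord1 mul0r mul0r.
by rewrite big_ord_recr /= IH -natr1; field.
Qed.

Lemma sum_ord_sqrE n :
  \sum_(i < n.+1) (i%:R : R) ^+ 2 = n%:R * (n%:R + 1) * (2 * n%:R + 1) / 6.
Proof.
elim: n => [|n IH]; first by rewrite big_ord1 expr0n !mul0r.
by rewrite big_ord_recr /= IH -natr1; field.
Qed.

Lemma sum_gap_ord i m : (i <= m)%N ->
  \sum_(j < m.+1) ((gap i j)%:R : R) = m%:R * (m%:R + 1) / 2 - i%:R * (m%:R - i%:R).
Proof.
have base k : (k <= i)%N -> \sum_(j < k.+1) ((gap i j)%:R : R) =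
    (k%:R + 1) * i%:R - k%:R * (k%:R + 1) / 2.
  elim: k => [|k IH] ki.
    by rewrite big_ord1 /gap subn0 sub0n addn0; field.
  rewrite big_ord_recr /= IH; last exact: ltnW.
  have -> : gap i k.+1 = (i - k.+1)%N by rewrite /gap; lia.
  by rewrite natrB// -natr1; field.
move=> im; rewrite -(subnKC im); elim: (m - i)%N => [|k IH].
  by rewrite addn0 base//; field.
rewrite addnS big_ord_recr /= IH.
have -> : gap i (i + k).+1 = k.+1 by rewrite /gap; lia.
by rewrite -!natr1 natrD; field.
Qed.

Lemma sum_gap_sqr_ord i m : \sum_(j < m.+1) ((gap i j)%:R : R) ^+ 2 =
  (m%:R + 1) * i%:R ^+ 2 - i%:R * m%:R * (m%:R + 1) + m%:R * (m%:R + 1) * (2 * m%:R + 1) / 6.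
Proof.
have -> : \sum_(j < m.+1) ((gap i j)%:R : R) ^+ 2 =
   \sum_(j < m.+1) i%:R ^+ 2 - 2 * i%:R * (\sum_(j < m.+1) j%:R) + \sum_(j < m.+1) j%:R ^+ 2.
  rewrite mulr_sumr -sumrB -big_split; apply: eq_bigr => j _ /=; rewrite gap_sqr; ring.
by rewrite sumr_const card_ord sum_ordE sum_ord_sqrE -mulr_natl -natr1; field.
Qed.

End PowerSums.

(** * Adding an edge to a tree *)

Section TreeIdentities.
Variables (R : realType) (V : finType) (e : rel V).
Hypothesis e_sym : symmetric e.
Hypothesis e_irr : irreflexive e.
Hypothesis e_conn : connected_graph e.
Hypothesis acyclic : ~ (exists cy : seq V, [/\ uniq cy, 3 <= size cy & cycle e cy])%N.
Variable d : V -> V -> nat.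
Hypothesis dP : graph_distance e d.
Hypothesis V_gt1 : (1 < #|V|)%N.

Local Notation D u v := ((d u v)%:R : R).
Local Notation degR u := ((deg e u)%:R : R).
Local Notation N := (#|V|%:R : R).

Lemma tree_deg_gt0 v : (0 < deg e v)%N.
Proof.
have /card_gt1P[a [b [_ _ ab]]] := V_gt1.
have [z vz] : exists z, v != z.
  by have [va|] := eqVneq v a; [exists b; rewrite va | exists a].
have [l vl _] := parent_exists e_irr dP vz.
by apply/card_gt0P; exists l; rewrite inE.
Qed.

(** Away from [z] exactly one neighbour is nearer to [z] and the others are farther; at [z] all are
    farther. So the distance is a resistance with [a u = 2 - deg e u]. *)
Lemma lap_dist (u z : V) : lap e (fun v => D v z) u = 2 - degR u - 2 * (u == z)%:R.
Proof.
have [->|uz] := eqVneq u z.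
  rewrite /lap -(sum_edge_deg R e) mulr1n mulr1 addrAC subrr sub0r -sumrN.
  apply: eq_bigr => l _; case zl: (e z l); last by rewrite mul0r oppr0.
  by rewrite (dist_refl dP) (dist_sym e_sym dP) (dist_edge e_irr dP zl) sub0r mul1r.
have [a ua da] := parent_exists e_irr dP uz.
rewrite mulr0n mulr0 subr0 /lap -(sum_edge_deg R e).
rewrite [in LHS](bigD1 a)//= [in RHS](bigD1 a)//= ua da -natrB// subSnn.
rewrite (eq_bigr (fun l => - (e u l)%:R)) ?sumrN; first by rewrite !mulr1n; ring.
move=> l la; case ul: (e u l); last by rewrite mul0r oppr0.
case: (dist_adj e_sym e_irr acyclic dP z ul) => [->|dl].
  by rewrite -da -natr1 opprD addrA subrr sub0r mul1r.
case/eqP: la; apply: (parent_unique e_sym e_irr acyclic dP (z := z) ul ua); lia.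
Qed.

Lemma sum_lap (f : V -> R) : \sum_u lap e f u = 0.
Proof.
have := sum_lapM e_sym f (fun=> 1).
under eq_bigr do rewrite mulr1; move=> ->; apply: big1 => u _.
by rewrite /lap big1 ?mulr0// => l _; rewrite subrr mulr0.
Qed.

Lemma lap_sqr (f : V -> R) u :
  lap e (fun v => f v ^+ 2) u = 2 * f u * lap e f u - \sum_l (e u l)%:R * (f u - f l) ^+ 2.
Proof.
rewrite /lap mulr_sumr -sumrB; apply: eq_bigr => l _; ring.
Qed.

Lemma sum_delta (f : V -> R) z : \sum_u (u == z)%:R * f u = f z.
Proof.
rewrite (bigD1 z)//= eqxx mul1r big1 ?addr0// => u /negbTE ->.
by rewrite mul0r.
Qed.

(** Summing [lap_dist] to zero counts the edges of the tree. *)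
Lemma sum_deg : \sum_u degR u = 2 * (N - 1).
Proof.
have /card_gt1P[z _] := V_gt1.
have := sum_lap (fun v => D v z); under eq_bigr do rewrite lap_dist -[X in _ - 2 * X]mulr1.
rewrite !sumrB sumr_const -mulr_sumr sum_delta -mulr_natr => /eqP.
by rewrite subr_eq0 subr_eq => /eqP H; apply/eqP; rewrite -subr_eq0; lra.
Qed.

(** [lap_sqr] for the distance, summed to zero: each edge changes the distance by one, so the
    correction term is the degree. *)
Lemma sum_deg_dist z : \sum_u degR u * D u z = 2 * \sum_u D u z - (N - 1).
Proof.
have := sum_lap (fun u => D u z ^+ 2).
under eq_bigr do rewrite lap_sqr lap_dist.
rewrite sumrB.
have -> : \sum_u \sum_l (e u l)%:R * (D u z - D l z) ^+ 2 = \sum_u degR u.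
  apply: eq_bigr => u _; rewrite -(sum_edge_deg R e); apply: eq_bigr => l _.
  case ul: (e u l); last by rewrite mul0r.
  by case: (dist_adj e_sym e_irr acyclic dP z ul) => ->; rewrite -natr1 mulr1n; ring.
have -> : \sum_u 2 * D u z * (2 - degR u - 2 * (u == z)%:R) =
    4 * \sum_u D u z - 2 * \sum_u degR u * D u z - 4 * \sum_u (u == z)%:R * D u z.
  by rewrite !mulr_sumr -!sumrB; apply: eq_bigr => u _; ring.
rewrite sum_delta (dist_refl dP) sum_deg; lra.
Qed.

Lemma sum_deg_deg_dist : \sum_u \sum_v degR u * degR v * D u v =
  4 * \sum_u \sum_v D u v - 2 * (N - 1) * (2 * N - 1).
Proof.
transitivity (\sum_v degR v * (2 * \sum_u D u v - (N - 1))).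
  rewrite exchange_big; apply: eq_bigr => v _ /=; rewrite -sum_deg_dist mulr_sumr.
  by apply: eq_bigr => u _; ring.
transitivity (2 * (\sum_u \sum_v degR v * D v u) - 2 * (N - 1) ^+ 2).
  have -> : 2 * (N - 1) ^+ 2 = \sum_v degR v * (N - 1) by rewrite -mulr_suml sum_deg; ring.
  rewrite mulr_sumr -sumrB.
  under eq_bigr do rewrite mulrBr.
  rewrite !sumrB; congr (_ - _).
  rewrite -mulr_sumr exchange_big mulr_sumr; apply: eq_bigr => v _ /=.
  rewrite mulrCA; congr (_ * _); rewrite mulr_sumr.
  by apply: eq_bigr => u _; rewrite (dist_sym e_sym dP).
under eq_bigr do rewrite sum_deg_dist.
rewrite sumrB sumr_const -mulr_sumr -[in X in _ - X]mulr_natr exchange_big /=; ring.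
Qed.

(** * Position and height relative to a path *)

Section Position.
Variables (x : V) (t : seq V).
Hypotheses (tP : path e x t) (tU : uniq (x :: t)).
Let s := x :: t.
Let y := last x t.
Let m := size t.

Let dxy : d x y = m.
Proof. exact: dist_path_ends. Qed.

Let dyx : d y x = m.
Proof. by rewrite (dist_sym e_sym dP). Qed.

(* [dist_pos_ht] shows that the halvings are exact and the differences are not truncated:
   [pos u] is the index of the projection of [u] on the path, [ht u] its distance to the path. *)
Definition pos (u : V) : nat := ((d u x + m) - d u y)./2.
Definition ht (u : V) : nat := ((d u x + d u y) - m)./2.

(** Along an edge both distances change by one, so the parity of their sum is constant. *)
Let dist_parity u : odd (d u x + d u y + m) = false.
Proof.
move En : (d u x) => n; elim: n u En => [|n IH] u En.
  by rewrite (dist0_eq dP En) dxy add0n oddD addbb.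
have ux : u != x by apply/eqP => ux; rewrite ux (dist_refl dP) in En.
have [l ul dl] := parent_exists e_irr dP ux.
have dln : d l x = n by move: dl; rewrite En => -[].
have := IH l dln; case: (dist_adj e_sym e_irr acyclic dP y ul); lia.
Qed.

Lemma dist_pos_ht u : d u x = (ht u + pos u)%N /\ (d u y + pos u = ht u + m)%N.
Proof.
have := dist_triangle dP x u y; have := dist_triangle dP y u x.
have := dist_triangle dP u x y; rewrite dxy dyx (dist_sym e_sym dP x u).
have := dist_parity u; rewrite /ht /pos.
move: (d u x) (d u y) => a b par le1 le2 le3.
have := odd_double_half (a + m - b); have := odd_double_half (a + b - m).
have -> : odd (a + b - m) = false by lia.
have -> : odd (a + m - b) = false by lia.
rewrite -!muln2; lia.
Qed.

Lemma pos_le u : (pos u <= m)%N.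
Proof.
have := dist_triangle dP y u x; rewrite dyx; have := dist_pos_ht u; lia.
Qed.

Lemma ht0P u : reflect (ht u = 0%N) (u \in s).
Proof.
apply: (iffP idP) => [|h0].
  case/(nthP x) => i it <-; have := dist_pos_ht (nth x s i).
  rewrite (dist_path_start e_sym e_irr acyclic dP tP tU it).
  rewrite (dist_path_end e_sym e_irr acyclic dP tP tU it) -/m.
  by move: it; rewrite /s /= -/m; lia.
have [dx dy] := dist_pos_ht u.
rewrite (geodesic_nth e_sym e_irr acyclic dP tP tU (u := u)); last by rewrite -/y -/m; lia.
by apply: mem_nth; rewrite /= -/m; have := pos_le u; lia.
Qed.

Lemma pos_nth i : (i <= m)%N -> pos (nth x s i) = i.
Proof.
move=> it; have := dist_pos_ht (nth x s i).
rewrite (dist_path_start e_sym e_irr acyclic dP tP tU)//.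
by have /ht0P -> : nth x s i \in s; [exact: mem_nth | case].
Qed.

Lemma pos_start : pos x = 0%N.
Proof. exact: (@pos_nth 0%N). Qed.

Lemma pos_end : pos y = m.
Proof. by have := pos_nth (leqnn m); rewrite nth_last. Qed.

(** The four-point condition for [u], [v] and the two ends. *)
Lemma dist_le_ht_pos u v :
  (d u v <= ht u + ht v + ((pos u - pos v) + (pos v - pos u)))%N.
Proof.
have := four_point e_sym e_irr acyclic dP u v x y; rewrite dxy.
have := dist_pos_ht u; have := dist_pos_ht v; have := pos_le u; have := pos_le v; lia.
Qed.

(** Off the path, an edge leading nearer to one end and farther from the other would break the
    four-point condition. *)
Lemma pos_edge u l : e u l -> u \notin s -> pos l = pos u.
Proof.
move=> ul us; have hu : ht u <> 0%N by move=> /ht0P; rewrite (negbTE us).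
have lu : e l u by rewrite e_sym.
have := four_point e_sym e_irr acyclic dP u x l y.
have := four_point e_sym e_irr acyclic dP u y l x.
have := dist_pos_ht u; have := dist_pos_ht l; have := pos_le u; have := pos_le l.
rewrite (dist_edge e_irr dP ul) dxy dyx !(dist_sym e_sym dP x) !(dist_sym e_sym dP y).
case: (dist_adj e_sym e_irr acyclic dP x ul) => ->;
case: (dist_adj e_sym e_irr acyclic dP y ul) => ->; lia.
Qed.

Local Notation A0 := [set u | (u \notin s) && (pos u == 0%N)].
Local Notation A1 := [set u | (u \notin s) && (pos u == m)].

Lemma pendent_at_endsP (a b : nat) : pendent_at_ends e s x y a b <->
  [/\ forall u, u \notin s -> ht u = 1%N /\ (pos u = 0%N \/ pos u = m), #|A0| = a & #|A1| = b].
Proof.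
have off u : u \notin s -> ht u <> 0%N by move=> us /ht0P; rewrite (negbTE us).
have ex u : e u x = (ht u + pos u == 1)%N.
  have [<- _] := dist_pos_ht u; apply/idP/eqP; [exact: dist_edge | exact: dist1_edge].
have ey u : e u y = (ht u + m == (pos u).+1)%N.
  have [_ <-] := dist_pos_ht u; rewrite -add1n eqn_add2r.
  apply/idP/eqP; [exact: dist_edge | exact: dist1_edge].
have sets : (forall u, u \notin s -> ht u = 1%N) ->
    [set u | e x u & u \notin s] = A0 /\ [set u | e y u & u \notin s] = A1.
  move=> H; split; apply/setP => u; rewrite !finset.in_set e_sym andbC.
    by rewrite ex; have [//|us /=] := boolP (u \in s); rewrite H// add1n eqSS.
  by rewrite ey; have [//|us /=] := boolP (u \in s); rewrite H// add1n eqSS eq_sym.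
split=> [[H <- <-]|[H <- <-]].
  have H' u : u \notin s -> ht u = 1%N /\ (pos u = 0%N \/ pos u = m).
    move=> us; have [_] := H u us; have := off u us; have := pos_le u.
    by rewrite ex ey => le h0 /orP[] /eqP ?; split; lia.
  by have [-> ->] := sets (fun u us => proj1 (H' u us)).
rewrite /pendent_at_ends; have [-> ->] := sets (fun u us => proj1 (H u us)); split=> // u us.
have [h1 pu] := H u us; split; last first.
  by rewrite ex ey h1 !add1n !eqSS; case: pu => ->; rewrite eqxx ?orbT.
(* All neighbours of [u] share its position; two adjacent vertices cannot both have height 1 there,
   so they lie on the path and are the vertex at that position. *)
have [z uz zE] : exists2 z, e u z & forall l, e u l -> l = z.
  have nbr l : e u l -> l \in s /\ pos l = pos u.
    move=> ul; have pl := pos_edge ul us; split=> //.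
    apply/negPn/negP => ls; have [hl _] := H l ls.
    have [dl _] := dist_pos_ht l; have [du _] := dist_pos_ht u.
    by case: (dist_adj e_sym e_irr acyclic dP x ul); lia.
  have nth_pos l : e u l -> l = nth x s (pos u).
    move=> /nbr[/(nthP x)[i it <-] <-]; rewrite pos_nth//.
  have /card_gt0P[z] := tree_deg_gt0 u; rewrite inE => uz.
  by exists z => // l ul; rewrite (nth_pos l ul) (nth_pos z uz).
rewrite /deg -(cards1 z); apply: eq_card => l; rewrite !inE.
by apply/idP/eqP => [/zE|->].
Qed.

(** An off-path vertex has its end of the path as parent towards any [v]; for two path vertices the
    four-point bound meets the triangle inequality. *)
Lemma dist_pendent :
  (forall u, u \notin s -> ht u = 1%N /\ (pos u = 0%N \/ pos u = m)) ->
  forall u v, u != v -> d u v = (ht u + ht v + gap (pos u) (pos v))%N.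
Proof.
move=> H.
have off u v : u \notin s -> u != v -> d u v = (ht u + ht v + gap (pos u) (pos v))%N.
  move=> us uv; have [l ul dl] := parent_exists e_irr dP uv.
  have [h1 pu] := H u us.
  have [dux duy] := dist_pos_ht u; have [dvx dvy] := dist_pos_ht v.
  have [dlx dly] := dist_pos_ht l; have pl := pos_edge ul us.
  have ls : ht l = 0%N.
    apply/ht0P/negPn/negP => ls; have [hl _] := H l ls.
    by case: (dist_adj e_sym e_irr acyclic dP x ul); lia.
  have pv := pos_le v.
  case: pu => pu.
    have lx : l = x by apply: (dist0_eq dP); lia.
    by rewrite dl lx (dist_sym e_sym dP) dvx h1 pu /gap; lia.
  have ly : l = y by apply: (dist0_eq dP); lia.
  by rewrite dl ly (dist_sym e_sym dP) h1 pu /gap; lia.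
move=> u v uv; have [us|us] := boolP (u \in s); last exact: off.
have [vs|vs] := boolP (v \in s); last first.
  by rewrite (dist_sym e_sym dP) off 1?eq_sym// gapC [(ht v + _)%N]addnC.
have := dist_le_ht_pos u v; have := dist_triangle dP v u x; have := dist_triangle dP u v x.
have := dist_pos_ht u; have := dist_pos_ht v.
rewrite (elimT (ht0P u) us) (elimT (ht0P v) vs) (dist_sym e_sym dP v u) /gap; lia.
Qed.

(** For [u] and its parent, at the same position, the hypothesis reads [1 = ht u + ht l] with [ht u]
    positive. *)
Lemma ht_eq1 u : (forall v, u != v -> d u v = (ht u + ht v + gap (pos u) (pos v))%N) ->
  u \notin s -> ht u = 1%N.
Proof.
move=> H us.
have hu : ht u <> 0%N by move=> /ht0P; rewrite (negbTE us).
have ux : u != x by apply: contraNneq us => ->; rewrite mem_head.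
have [l ul dl] := parent_exists e_irr dP ux.
have ul' : u != l by apply: contraTneq ul => ->; rewrite e_irr.
have := H l ul'; rewrite (dist_edge e_irr dP ul) (pos_edge ul us) /gap subnn.
have [dux _] := dist_pos_ht u; have [dlx _] := dist_pos_ht l; have := pos_edge ul us; lia.
Qed.

Local Notation P u := ((pos u)%:R : R).
Local Notation M := (m%:R : R).

Let distxE u : D u x = (ht u)%:R + P u.
Proof. by have [-> _] := dist_pos_ht u; rewrite natrD. Qed.

Let distyE u : D u y = (ht u)%:R + M - P u.
Proof.
by have [_] := dist_pos_ht u => /(congr1 (fun k => k%:R : R)); rewrite !natrD => <-; rewrite addrK.
Qed.

(** [pos u] is half of [d u x - d u y + m], so the degrees in [lap_dist] cancel: it is the potential
    of a unit current between the ends. *)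
Lemma lap_pos u : lap e (fun v => P v) u = (u == y)%:R - (u == x)%:R.
Proof.
transitivity (2^-1 * (lap e (fun v => D v x) u - lap e (fun v => D v y) u)).
  rewrite /lap -sumrB mulr_sumr; apply: eq_bigr => l _.
  by rewrite !distxE !distyE; field.
by rewrite !lap_dist; field.
Qed.

(* [Gam] is twice the carre du champ of [pos]; it vanishes off the path. *)
Let Gam u : R := \sum_l (e u l)%:R * (P u - P l) ^+ 2.

Let GamE u : Gam u = 2 * P u * lap e (fun v => P v) u - lap e (fun v => P v ^+ 2) u.
Proof. by rewrite lap_sqr opprB addrC subrK. Qed.

Let Px : P x = 0. Proof. by rewrite pos_start. Qed.
Let Py : P y = M. Proof. by rewrite pos_end. Qed.

Let sum_Gam : \sum_u Gam u = 2 * M.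
Proof.
under eq_bigr do rewrite GamE; rewrite sumrB sum_lap subr0.
transitivity (\sum_u (u == y)%:R * (2 * P u) - \sum_u (u == x)%:R * (2 * P u)).
  by rewrite -sumrB; apply: eq_bigr => u _; rewrite lap_pos; ring.
by rewrite !sum_delta Px Py; ring.
Qed.

Let sum_lap_pos_sqr : \sum_u lap e (fun v => P v) u * P u ^+ 2 = M ^+ 2.
Proof.
transitivity (\sum_u (u == y)%:R * P u ^+ 2 - \sum_u (u == x)%:R * P u ^+ 2).
  by rewrite -sumrB; apply: eq_bigr => u _; rewrite lap_pos; ring.
by rewrite !sum_delta Px Py; ring.
Qed.

(** By self-adjointness both terms of [GamE] give [sum_lap_pos_sqr], with coefficients 2 and -1. *)
Let sum_Gam_pos : \sum_u Gam u * P u = M ^+ 2.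
Proof.
transitivity (2 * (\sum_u lap e (fun v => P v) u * P u ^+ 2)
  - \sum_u P u * lap e (fun v => P v ^+ 2) u).
  by rewrite mulr_sumr -sumrB; apply: eq_bigr => u _; rewrite GamE; ring.
by rewrite -sum_lapM// !sum_lap_pos_sqr; ring.
Qed.

Lemma sum_deg_pos : \sum_u degR u * P u = 2 * \sum_u P u - M.
Proof.
transitivity (2^-1 * (\sum_u degR u * D u x - \sum_u degR u * D u y + M * \sum_u degR u)).
  rewrite mulr_sumr -sumrB -big_split mulr_sumr; apply: eq_bigr => u _ /=.
  by rewrite distxE distyE; field.
rewrite !sum_deg_dist sum_deg.
have : 2 * \sum_u P u = \sum_u D u x - \sum_u D u y + \sum_(u : V) M.
  rewrite mulr_sumr -sumrB -big_split; apply: eq_bigr => u _ /=.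
  by rewrite distxE distyE; ring.
by rewrite sumr_const -mulr_natr; lra.
Qed.

(** Integration by parts of [d u y] against [pos u ^+ 2]; [Gam] lives on the path, where [d u y] is
    [m - pos u]. *)
Lemma sum_deg_pos_sqr : \sum_u degR u * P u ^+ 2 = 2 * (\sum_u P u ^+ 2) - M ^+ 2.
Proof.
have := sum_lapM e_sym (fun u => D u y) (fun u => P u ^+ 2).
have -> : \sum_u lap e (fun v => D v y) u * P u ^+ 2 =
    2 * (\sum_u P u ^+ 2) - \sum_u degR u * P u ^+ 2 - 2 * \sum_u (u == y)%:R * P u ^+ 2.
  rewrite !mulr_sumr -!sumrB; apply: eq_bigr => u _; rewrite lap_dist; ring.
have Gam_dist u : Gam u * D u y = M * Gam u - Gam u * P u.
  rewrite distyE; have [us|us] := boolP (u \in s).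
    by rewrite (elimT (ht0P u) us); ring.
  suff -> : Gam u = 0 by rewrite !mul0r mulr0 subrr.
  apply: big1 => l _; case ul: (e u l); last by rewrite mul0r.
  by rewrite (pos_edge ul us) subrr expr0n mulr0.
have -> : \sum_u D u y * lap e (fun v => P v ^+ 2) u =
    2 * (\sum_u (u == y)%:R * (D u y * P u)) - 2 * (\sum_u (u == x)%:R * (D u y * P u))
    - (M * (\sum_u Gam u) - \sum_u Gam u * P u).
  rewrite !mulr_sumr -!sumrB; apply: eq_bigr => u _.
  by rewrite -Gam_dist GamE lap_pos; ring.
rewrite !sum_delta (dist_refl dP) Px Py sum_Gam sum_Gam_pos; lra.
Qed.

(** * The graph with the edge added *)

Hypotheses (xy_neq : x != y) (xy_nadj : ~~ e x y).
Let G := add_edge e x y.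

(** Distinct non-adjacent ends make the disjunction exclusive, hence a sum of indicators. *)
Lemma add_edgeE u l : (G u l)%:R = (e u l)%:R + (u == x)%:R * (l == y)%:R
  + (u == y)%:R * (l == x)%:R :> R.
Proof.
rewrite /G /add_edge; have yx : y == x = false by rewrite eq_sym (negbTE xy_neq).
have exy := negbTE xy_nadj; have eyx : e y x = false by rewrite e_sym.
have [->|ux] := eqVneq u x; have [->|ly] := eqVneq l y;
  rewrite ?exy ?yx ?(negbTE xy_neq) /=; rewrite ?orbF ?mulr1 ?mulr0 ?mul0r ?addr0 ?add0r//.
  by have [->|uy] := eqVneq u y; rewrite ?yx /= ?orbF ?mulr0 ?addr0 ?mul0r ?addr0.
have [->|uy] := eqVneq u y; rewrite /= ?orbF ?mul0r ?addr0// mul1r.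
by have [->|lx] := eqVneq l x; rewrite ?eyx /= ?orbF ?addr0 ?add0r.
Qed.

Lemma deg_add_edge u : (deg G u)%:R = degR u + (u == x)%:R + (u == y)%:R :> R.
Proof.
rewrite -!(sum_edge_deg R); under eq_bigr do rewrite add_edgeE.
rewrite !big_split /= -!mulr_sumr; congr (_ + _ + _).
  by under eq_bigr do rewrite -[_%:R]mulr1; rewrite sum_delta mulr1.
by under eq_bigr do rewrite -[_%:R]mulr1; rewrite sum_delta mulr1.
Qed.

Lemma lap_add_edge (f : V -> R) u :
  lap G f u = lap e f u + ((u == x)%:R - (u == y)%:R) * (f x - f y).
Proof.
rewrite /lap; under eq_bigr do rewrite add_edgeE.
transitivity (lap e f u + (u == x)%:R * (\sum_l (l == y)%:R * (f u - f l))
  + (u == y)%:R * (\sum_l (l == x)%:R * (f u - f l))).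
  by rewrite /lap !mulr_sumr -!big_split; apply: eq_bigr => l _ /=; ring.
rewrite (sum_delta (fun l => f u - f l)) (sum_delta (fun l => f u - f l)) -/(lap e f u).
have [->|ux] := eqVneq u x; first by rewrite (negbTE xy_neq) mulr1n mulr0n; ring.
by have [->|uy] := eqVneq u y; rewrite ?mulr1n ?mulr0n; ring.
Qed.

Lemma sum_deg_add_edge (f : V -> R) :
  \sum_u (deg G u)%:R * f u = \sum_u degR u * f u + f x + f y.
Proof.
under eq_bigr do rewrite deg_add_edge !mulrDl.
by rewrite !big_split /= !sum_delta.
Qed.

Local Notation degG u := ((deg G u)%:R : R).
Local Notation C := (M + 1).

Lemma sum_degG : \sum_u degG u = 2 * N.
Proof.
have := sum_deg_add_edge (fun=> 1); under eq_bigr do rewrite mulr1; move=> ->.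
by under eq_bigr do rewrite mulr1; rewrite sum_deg; ring.
Qed.

(** A weighted variance: only three moments of [pos] matter, and the extra degrees at the ends
    cancel the boundary terms, making each moment exactly twice its unweighted value. *)
Lemma sum_degG_pos_diff_sqr :
  \sum_u \sum_v degG u * degG v * (P u - P v) ^+ 2 = 4 * \sum_u \sum_v (P u - P v) ^+ 2.
Proof.
have expand (w : V -> R) : \sum_u \sum_v w u * w v * (P u - P v) ^+ 2 =
    2 * ((\sum_u w u * P u ^+ 2) * (\sum_u w u) - (\sum_u w u * P u) ^+ 2).
  transitivity (\sum_u (w u * P u ^+ 2 * (\sum_v w v) - 2 * (w u * P u) * (\sum_v w v * P v)
     + w u * (\sum_v w v * P v ^+ 2))).
    apply: eq_bigr => u _; rewrite !mulr_sumr -sumrB -big_split; apply: eq_bigr => v _ /=; ring.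
  by rewrite big_split sumrB /= -!mulr_suml -mulr_sumr; ring.
have := expand (fun=> 1).
have -> : \sum_u \sum_v 1 * 1 * (P u - P v) ^+ 2 = \sum_u \sum_v (P u - P v) ^+ 2.
  by apply: eq_bigr => u _; apply: eq_bigr => v _; rewrite !mul1r.
have -> : \sum_(u : V) 1 = N by rewrite sumr_const.
under [in X in _ = X -> _]eq_bigr do rewrite mul1r.
under [X in _ - X ^+ 2]eq_bigr do rewrite mul1r.
move=> ->; rewrite expand sum_degG !sum_deg_add_edge sum_deg_pos_sqr sum_deg_pos Px Py; ring.
Qed.

Let M1_neq0 : C != 0. Proof. by rewrite natr1 pnatr_eq0. Qed.

(* The rank-one update of the resistance by the edge between [x] and [y]. *)
Definition resistance_add_edge (u v : V) : R := D u v - (P u - P v) ^+ 2 / C.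

(** The new edge multiplies the Laplacian of [pos] by [C], so the cross term of the square cancels
    the part depending on [z] of the jump [2 * P z - M] of the distance across that edge. *)
Lemma lap_resistance_add_edge u z :
  lap G (fun v => resistance_add_edge v z) u =
  (2 - degR u - lap G (fun v => P v ^+ 2) u / C - M * ((u == x)%:R - (u == y)%:R))
   - 2 * (u == z)%:R.
Proof.
have -> : lap G (fun v => resistance_add_edge v z) u =
    lap G (fun v => D v z) u - lap G (fun v => P v ^+ 2) u / C
    + 2 * P z / C * lap G (fun v => P v) u.
  rewrite /lap mulr_suml mulr_sumr -sumrB -big_split; apply: eq_bigr => l _ /=.
  by rewrite /resistance_add_edge; field.
rewrite [lap G (fun v => P v) u]lap_add_edge lap_pos [lap G (fun v => D v z) u]lap_add_edge.
rewrite lap_dist Px Py !(dist_sym e_sym dP _ z) distxE distyE.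
by field.
Qed.

Lemma kemeny_difference (wT wG : V -> R) (jT jG : V) :
  stationary e wT -> stationary G wG ->
  4 * C * N * (N - 1) * (kemeny G wG jG - kemeny e wT jT) =
  C * (2 * (N - 1) * (2 * N - 1) - 4 * \sum_u \sum_v D u v)
  + (N - 1) * (4 * C * (N * M + 2 * \sum_u (ht u)%:R) - 4 * C * (N - 1) + 2 * C * M)
  - 4 * (N - 1) * \sum_u \sum_v (P u - P v) ^+ 2.
Proof.
move=> sT sG.
have G_sym : symmetric G.
  move=> u v; rewrite /G /add_edge e_sym; congr (_ || _).
  by rewrite orbC; congr (_ || _); rewrite andbC.
have G_conn : connected_graph G.
  move=> u v; apply: (connect_sub _ (e_conn u v)) => a b ab.
  by apply: connect1; rewrite /G /add_edge ab.
have G_deg u : (0 < deg G u)%N.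
  rewrite -(ltr0n R) deg_add_edge -addrA ltr_wpDr ?addr_ge0 ?ler0n//.
  by rewrite ltr0n tree_deg_gt0.
have res0 k : resistance_add_edge k k = 0.
  by rewrite /resistance_add_edge (dist_refl dP) subrr expr0n mul0r subrr.
rewrite (kemeny_resistance G_sym G_conn G_deg res0 lap_resistance_add_edge jG sG).
have d0 k : D k k = 0 by rewrite (dist_refl dP).
rewrite (kemeny_resistance (D := fun u v => D u v) e_sym e_conn tree_deg_gt0 d0 lap_dist jT sT).
rewrite sum_deg sum_degG sum_deg_deg_dist.
have -> : \sum_u \sum_v degG u * degG v * resistance_add_edge u v =
   \sum_u \sum_v degG u * degG v * D u v - (\sum_u \sum_v degG u * degG v * (P u - P v) ^+ 2) / C.
  rewrite mulr_suml -sumrB; apply: eq_bigr => u _.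
  by rewrite mulr_suml -sumrB; apply: eq_bigr => v _; rewrite /resistance_add_edge; ring.
rewrite sum_degG_pos_diff_sqr.
(* The extra degrees at [x] and [y] add, in each variable, the sums of distances to the ends. *)
have -> : \sum_u \sum_v degG u * degG v * D u v =
   \sum_u \sum_v degR u * degR v * D u v + 4 * (\sum_u D u x + \sum_u D u y) - 4 * (N - 1) + 2 * M.
  transitivity (\sum_u degG u * (\sum_v degR v * D u v + D u x + D u y)).
    apply: eq_bigr => u _; rewrite -sum_deg_add_edge mulr_sumr; apply: eq_bigr => v _; ring.
  rewrite sum_deg_add_edge; under [X in X + _ + _]eq_bigr do rewrite !mulrDr.
  rewrite !big_split /= !sum_deg_dist !(dist_refl dP) dxy dyx.
  have -> : \sum_v degR v * D x v = \sum_v degR v * D v x.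
    by apply: eq_bigr => v _; rewrite (dist_sym e_sym dP).
  have -> : \sum_v degR v * D y v = \sum_v degR v * D v y.
    by apply: eq_bigr => v _; rewrite (dist_sym e_sym dP).
  have -> : \sum_u degR u * (\sum_v degR v * D u v) = \sum_u \sum_v degR u * degR v * D u v.
    by apply: eq_bigr => u _; rewrite mulr_sumr; apply: eq_bigr => v _; ring.
  rewrite !sum_deg_dist; ring.
have -> : \sum_u D u x + \sum_u D u y = 2 * (\sum_u (ht u)%:R) + N * M.
  have -> : N * M = \sum_(u : V) M by rewrite sumr_const mulr_natl.
  rewrite mulr_sumr -!big_split; apply: eq_bigr => u _ /=.
  by rewrite distxE distyE; ring.
rewrite sum_deg_deg_dist.
have N0 : N != 0 by rewrite pnatr_eq0 -lt0n ltnW.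
have N1 : N - 1 != 0 by rewrite subr_eq0 pnatr_eq1 gtn_eqF.
by field; rewrite M1_neq0 N0 N1.
Qed.

(** * Splitting the sums between the path and its complement *)

Let szs : (size s)%:R = C :> R. Proof. by rewrite -natr1. Qed.

Let NsubC : (#|V| - size s)%N = #|[set u | u \notin s]|.
Proof.
have <- : #|s| = size s by apply/card_uniqP.
rewrite -(cardC (mem s)) addKn; apply: eq_card => u.
by rewrite !inE.
Qed.

Local Notation B := [set u | u \notin s].
Local Notation K := (#|B|%:R : R).

Let NE : N = C + K.
Proof.
rewrite -szs -natrD -NsubC subnKC//.
by have <- : #|s| = size s; [apply/card_uniqP | exact: max_card].
Qed.

Let cost (i j : nat) : R := C * (gap i j)%:R + (N - 1) * (gap i j)%:R ^+ 2.

Let sum_path (F : nat -> R) : \sum_(v in s) F (pos v) = \sum_(i < m.+1) F i.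
Proof.
rewrite -big_uniq// (big_nth x) big_mkord; apply: eq_bigr => i _.
by rewrite pos_nth// -ltnS.
Qed.

(** The linear and quadratic sums combine so that [i] enters only through [i (m - i)], which
    vanishes at the ends. *)
Let path_cost i : (i <= m)%N -> \sum_(v in s) cost i (pos v) =
  C * (M * C / 2) + (N - 1) * (M * C * (2 * M + 1) / 6) - N * C * (i%:R * (M - i%:R)).
Proof.
move=> im; rewrite (sum_path (cost i)) /cost big_split -!mulr_sumr /=.
by rewrite sum_gap_ord// sum_gap_sqr_ord; field.
Qed.

Let total_path_cost : \sum_(u in s) \sum_(v in s) cost (pos u) (pos v) =
  C * (C * M * (M + 2) / 3) + (N - 1) * (C ^+ 2 * M * (M + 2) / 6).
Proof.
under eq_bigr do rewrite path_cost ?pos_le//.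
pose F i := C * (M * C / 2) + (N - 1) * (M * C * (2 * M + 1) / 6) - N * C * (i%:R * (M - i%:R)).
rewrite -[LHS]/(\sum_(u in s) F (pos u)) sum_path /F sumrB.
rewrite sumr_const card_ord -[X in X - _]mulr_natr -natr1.
have -> : \sum_(i < m.+1) N * C * (i%:R * (M - i%:R)) =
    N * C * (M * (\sum_(i < m.+1) i%:R) - \sum_(i < m.+1) i%:R ^+ 2).
  by rewrite mulrBr !mulr_sumr -sumrB; apply: eq_bigr => i _; ring.
by rewrite sum_ordE sum_ord_sqrE; field.
Qed.

(** Diagonal terms, equal to [2 * ht u], are left out: they do not vanish for pendent vertices. *)
Definition branch_defect : R :=
  \sum_u \sum_(v | v != u) ((ht u + ht v + gap (pos u) (pos v))%:R - D u v).

Definition offpath_cost : R :=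
  \sum_(u in B) \sum_(v in B)
    (C * (gap (pos u) (pos v))%:R + (N - 1) * (gap (pos u) (pos v))%:R ^+ 2).

Let total_cost : \sum_u \sum_v cost (pos u) (pos v) =
  C * (C * M * (M + 2) / 3) + (N - 1) * (C ^+ 2 * M * (M + 2) / 6)
  + 2 * (K * (C * (M * C / 2) + (N - 1) * (M * C * (2 * M + 1) / 6))
         - N * C * \sum_(u in B) P u * (M - P u)) + offpath_cost.
Proof.
have split_s (f : V -> R) : \sum_u f u = \sum_(u in s) f u + \sum_(u in B) f u.
  by rewrite (bigID (mem s)) /=; congr (_ + _); apply: eq_bigl => u; rewrite inE.
rewrite split_s; under eq_bigr do rewrite split_s.
under [X in _ + X]eq_bigr do rewrite split_s.
rewrite !big_split /= total_path_cost -/offpath_cost.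
have -> : \sum_(u in s) \sum_(v in B) cost (pos u) (pos v) =
    \sum_(u in B) \sum_(v in s) cost (pos u) (pos v).
  by rewrite exchange_big; apply: eq_bigr => u _; apply: eq_bigr => v _; rewrite /cost gapC.
have -> : \sum_(u in B) \sum_(v in s) cost (pos u) (pos v) =
  K * (C * (M * C / 2) + (N - 1) * (M * C * (2 * M + 1) / 6))
         - N * C * \sum_(u in B) P u * (M - P u).
  under eq_bigr do rewrite path_cost ?pos_le//.
  by rewrite sumrB sumr_const -[X in X - _]mulr_natl -mulr_sumr.
rewrite /offpath_cost; ring.
Qed.

Let sum_dist : \sum_u \sum_v D u v =
  2 * (N - 1) * (\sum_u (ht u)%:R) + \sum_u \sum_v (gap (pos u) (pos v))%:R - branch_defect.
Proof.
have -> : branch_defect = \sum_u \sum_v ((ht u + ht v + gap (pos u) (pos v))%:R - D u v)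
   - 2 * \sum_u (ht u)%:R.
  rewrite mulr_sumr -sumrB; apply: eq_bigr => u _; rewrite [in RHS](bigD1 u)//=.
  by rewrite (dist_refl dP) /gap subnn !addn0 natrD; ring.
have -> : \sum_u \sum_v ((ht u + ht v + gap (pos u) (pos v))%:R - D u v) =
   \sum_u \sum_(v : V) (ht u)%:R + \sum_(u : V) \sum_v (ht v)%:R +
   \sum_u \sum_v (gap (pos u) (pos v))%:R - \sum_u \sum_v D u v.
  rewrite -!big_split -sumrB; apply: eq_bigr => u _ /=.
  by rewrite -!big_split -sumrB; apply: eq_bigr => v _ /=; rewrite !natrD.
have cst (z : R) : \sum_(v : V) z = N * z by rewrite sumr_const mulr_natl.
have -> : \sum_(u : V) \sum_v (ht v)%:R = N * \sum_v (ht v)%:R :> R by exact: cst.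
have -> : \sum_u \sum_(v : V) (ht u)%:R = N * \sum_u (ht u)%:R :> R.
  by rewrite mulr_sumr; apply: eq_bigr => u _; exact: cst.
ring.
Qed.

(** The height sums of [kemeny_difference] and [sum_dist] cancel, and the gap sums combine into
    [cost], evaluated by [total_cost]; [bound41] accounts for the path terms and the even split. *)
Lemma kemeny_defect (wT wG : V -> R) (jT jG : V) :
  stationary e wT -> stationary G wG ->
  4 * C * N * (N - 1) * (kemeny G wG jG - kemeny e wT jT - bound41 R #|V| (size s)) =
  4 * C * branch_defect + 8 * C * N * (\sum_(u in B) P u * (M - P u))
  + 4 * (2 * (#|B|./2 * uphalf #|B|)%:R * (C * M + (N - 1) * M ^+ 2) - offpath_cost).
Proof.
move=> sT sG.
have N0 : N != 0 by rewrite pnatr_eq0 -lt0n ltnW.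
have N1 : N - 1 != 0 by rewrite subr_eq0 pnatr_eq1 gtn_eqF.
rewrite mulrBr (kemeny_difference jT jG sT sG) sum_dist.
have -> : \sum_u \sum_v (P u - P v) ^+ 2 = \sum_u \sum_v (gap (pos u) (pos v))%:R ^+ 2.
  by apply: eq_bigr => u _; apply: eq_bigr => v _; rewrite gap_sqr.
rewrite /bound41 szs NsubC mulrA divff ?mul1r; last by rewrite !mulf_neq0// pnatr_eq0.
have := total_cost.
have -> : \sum_u \sum_v cost (pos u) (pos v) = C * (\sum_u \sum_v (gap (pos u) (pos v))%:R)
   + (N - 1) * (\sum_u \sum_v (gap (pos u) (pos v))%:R ^+ 2).
  rewrite !mulr_sumr -big_split; apply: eq_bigr => u _ /=.
  by rewrite !mulr_sumr -big_split; apply: eq_bigr => v _ /=.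
set g1 := \sum_u \sum_v _; set g2 := \sum_u \sum_v _.
move=> /(congr1 (fun z => z - (N - 1) * g2)); rewrite addrK => g1E.
rewrite natrM.
transitivity (4 * C * branch_defect - 4 * (C * g1) - 4 * (N - 1) * g2
  + C * (2 * (N - 1) * (2 * N - 1)) + (N - 1) * (4 * C * N * M - 4 * C * (N - 1) + 2 * C * M)
  - (- (2 / 3) * (N + 1) * C ^+ 2 * (C ^+ 2 - 1)
    - 8 * (N - C) * (- N * C ^+ 2 + C * (C + 1) / 6 * ((2 * N + 1) * C + N - 1))
    - 8 * (#|B|./2)%:R * (uphalf #|B|)%:R * ((N - 1) * (C - 1) ^+ 2 + C * (C - 1))
    + 4 * N * (N - 1) * C * (C - 1) + 2 * (N - 1) * C ^+ 2)); first by ring.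
by rewrite g1E NE; field.
Qed.

(** * Signs of the three terms and their vanishing *)

Lemma branch_defect_terms_ge0 u v : 0 <= (ht u + ht v + gap (pos u) (pos v))%:R - D u v.
Proof. by rewrite subr_ge0 ler_nat; exact: dist_le_ht_pos. Qed.

Lemma branch_defect_ge0 : 0 <= branch_defect.
Proof.
by apply: sumr_ge0 => u _; apply: sumr_ge0 => v _; exact: branch_defect_terms_ge0.
Qed.

Lemma branch_defect0P : branch_defect = 0 <->
  forall u v, u != v -> d u v = (ht u + ht v + gap (pos u) (pos v))%N.
Proof.
split=> [/eqP|H]; last first.
  by apply: big1 => u _; apply: big1 => v vu; rewrite H ?subrr// eq_sym.
rewrite psumr_eq0 => [/allP H u v uv|u _]; last first.
  by apply: sumr_ge0 => v _; exact: branch_defect_terms_ge0.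
have /= := H u (mem_index_enum u).
rewrite psumr_eq0 => [/allP/(_ v (mem_index_enum v))|w _]; last exact: branch_defect_terms_ge0.
by rewrite eq_sym uv /= subr_eq0 eqr_nat => /eqP.
Qed.

Lemma offpath_pos_ge0 u : 0 <= P u * (M - P u).
Proof. by rewrite mulr_ge0// subr_ge0 ler_nat pos_le. Qed.

Lemma offpath_pos0P : \sum_(u in B) P u * (M - P u) = 0 <->
  forall u, u \notin s -> pos u = 0%N \/ pos u = m.
Proof.
split=> [/eqP|H]; last first.
  by apply: big1 => u; rewrite inE => /H[] ->; rewrite ?mul0r// subrr mulr0.
rewrite psumr_eq0 => [/allP H u us|u _]; last exact: offpath_pos_ge0.
have := H u (mem_index_enum u); rewrite inE us /= mulf_eq0 pnatr_eq0 subr_eq0 eqr_nat.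
by case/orP => /eqP; [left | right].
Qed.

Let N1_gt0 : 0 < N - 1. Proof. by rewrite subr_gt0 ltr1n. Qed.

(** No gap exceeds [m], so its square is at most [m] times it; [sum_gap_le] bounds the resulting
    linear sum. *)
Lemma offpath_cost_le :
  offpath_cost <= 2 * (#|B|./2 * uphalf #|B|)%:R * (C * M + (N - 1) * M ^+ 2).
Proof.
apply: (@le_trans _ _ ((C + (N - 1) * M) *
    (\sum_(u in B) \sum_(v in B) gap (pos u) (pos v))%:R)).
  rewrite natr_sum mulr_sumr; apply: ler_sum => u _.
  rewrite natr_sum mulr_sumr; apply: ler_sum => v _.
  rewrite [leRHS]mulrDl lerD2l -mulrA ler_wpM2l ?(ltW N1_gt0)// expr2 ler_wpM2r// ler_nat.
  by have := pos_le u; have := pos_le v; rewrite /gap; lia.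
have -> : 2 * (#|B|./2 * uphalf #|B|)%:R * (C * M + (N - 1) * M ^+ 2) =
  (C + (N - 1) * M) * (2 * (m * (#|B|./2 * uphalf #|B|)))%:R by rewrite !natrM; ring.
rewrite ler_wpM2l ?ler_nat ?sum_gap_le//; last exact: pos_le.
by rewrite addr_ge0// ?mulr_ge0// ltW.
Qed.

Hypothesis m_gt0 : (0 < m)%N.

(** Only pairs at opposite ends have a nonzero gap, namely [m]; the two orders give the factor 2. *)
Lemma offpath_cost_ends : (forall u, u \notin s -> pos u = 0%N \/ pos u = m) ->
  offpath_cost = 2 * (#|A0| * #|A1|)%:R * (C * M + (N - 1) * M ^+ 2).
Proof.
move=> ends; set g := C * M + _.
have cardA k : #|[set u | (u \notin s) && (pos u == k)]|%:R = \sum_(u in B) (pos u == k)%:R :> R.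
  rewrite -natr_sum; congr (_%:R); rewrite -sum1_card big_mkcond [RHS]big_mkcond.
  by apply: eq_bigr => u _; rewrite !finset.in_set; case: (u \in s); case: (_ == _).
have -> : offpath_cost =
   \sum_(u in B) \sum_(v in B) (pos u == 0%N)%:R * (pos v == m)%:R * g
   + \sum_(u in B) \sum_(v in B) (pos v == 0%N)%:R * (pos u == m)%:R * g.
  rewrite -big_split; apply: eq_bigr => u uB; rewrite -big_split; apply: eq_bigr => v vB /=.
  have m0 : (m == 0%N) = false by rewrite gtn_eqF.
  move: uB vB; rewrite !finset.in_set => /ends[] -> /ends[] ->;
    rewrite /gap ?subnn ?subn0 ?sub0n ?addn0 ?add0n ?eqxx ?m0 ?[0%N == m]eq_sym ?m0 /g;
    by rewrite ?mulr1n ?mulr0n; ring.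
have prod (f h : V -> R) : \sum_(u in B) \sum_(v in B) f u * h v * g =
    (\sum_(u in B) f u) * (\sum_(v in B) h v) * g.
  rewrite -mulrA mulr_suml; apply: eq_bigr => u _; rewrite mulr_suml mulr_sumr.
  by apply: eq_bigr => v _; rewrite mulrA.
rewrite [X in _ + X]exchange_big /= !(prod (fun u => (pos u == 0%N)%:R) (fun u => (pos u == m)%:R)).
by rewrite natrM !cardA; ring.
Qed.

Let offpath_split : (forall u, u \notin s -> pos u = 0%N \/ pos u = m) ->
  (#|A0| + #|A1|)%N = #|B|.
Proof.
move=> ends; rewrite -cardsUI.
have -> : A0 :&: A1 = finset.set0.
  apply/setP => u; rewrite !finset.in_set.
  apply/negbTE/negP => /andP[/andP[_ /eqP ->] /andP[_ /eqP m0]].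
  by have := m_gt0; rewrite -m0.
rewrite cards0 addn0; apply: eq_card => u; rewrite !finset.in_set -andb_orr.
by case us: (u \in s) => //=; case: (ends u (negbT us)) => ->; rewrite eqxx ?orbT.
Qed.

Lemma kemeny_bound (wT wG : V -> R) (jT jG : V) :
  stationary e wT -> stationary G wG ->
  bound41 R #|V| (size s) <= kemeny G wG jG - kemeny e wT jT /\
  (kemeny G wG jG - kemeny e wT jT = bound41 R #|V| (size s) <->
     pendent_at_ends e s x y (#|V| - size s)./2 (uphalf (#|V| - size s)) \/
     pendent_at_ends e s x y (uphalf (#|V| - size s)) (#|V| - size s)./2).
Proof.
move=> sT sG; have := kemeny_defect jT jG sT sG; rewrite NsubC.
set diff := kemeny _ _ _ - kemeny _ _ _; set bnd := bound41 _ _ _.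
set pp := \sum_(u in B) _; set oc := _ - offpath_cost.
have N_gt0 : 0 < N by rewrite ltr0n ltnW.
have C_gt0 : 0 < C by rewrite ltr_wpDl.
have M_gt0 : 0 < M by rewrite ltr0n.
have c0 : 0 < 4 * C * N * (N - 1) by rewrite !mulr_gt0.
have c1 : 0 < 4 * C by rewrite !mulr_gt0.
have c2 : 0 < 8 * C * N by rewrite !mulr_gt0.
have def0 := branch_defect_ge0.
have pp0 : 0 <= pp by apply: sumr_ge0 => u _; exact: offpath_pos_ge0.
have oc0 : 0 <= oc by rewrite subr_ge0 offpath_cost_le.
have g0 : 0 < C * M + (N - 1) * M ^+ 2 by rewrite addr_gt0 ?mulr_gt0 ?exprn_gt0.
move=> E; split.
  rewrite -subr_ge0 -(pmulr_rge0 _ c0) E !addr_ge0 ?mulr_ge0// ltW//.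
have -> : diff = bnd <-> [/\ branch_defect = 0, pp = 0 & oc = 0].
  split=> [eq|[b0 p0 o0]]; last first.
    move/eqP: E; rewrite b0 p0 o0 !mulr0 !addr0 mulf_eq0 (gt_eqF c0) /= subr_eq0.
    by move/eqP.
  move/eqP: E; rewrite eq subrr mulr0 eq_sym.
  rewrite !paddr_eq0 ?addr_ge0 ?mulr_ge0// ?(ltW c1)// ?(ltW c2)//.
  rewrite (mulf_eq0 (4 * C)) (gt_eqF c1) (mulf_eq0 (8 * C * N)) (gt_eqF c2) (mulf_eq0 4).
  rewrite pnatr_eq0 /=.
  by move=> /andP[/andP[/eqP ? /eqP ?] /eqP ?].
rewrite !pendent_at_endsP.
have ocE : (forall u, u \notin s -> pos u = 0%N \/ pos u = m) ->
   oc = 0 <-> (#|A0| * #|A1| = #|B|./2 * uphalf #|B|)%N.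
  move=> ends; rewrite /oc offpath_cost_ends// -mulrBl -mulrBr; split=> [/eqP|->].
    rewrite mulf_eq0 (gt_eqF g0) orbF mulf_eq0 pnatr_eq0 /= subr_eq0 eqr_nat.
    by move/eqP.
  by rewrite subrr mulr0 mul0r.
(* The second term puts the positions at the ends, the third balances the counts, and the first
   gives height 1. *)
split=> [[b0 /offpath_pos0P ends o0]|H].
  have := @mul_eq_half #|A0| #|A1|; rewrite offpath_split// => -/(_ (proj1 (ocE ends) o0)).
  have Hp u : u \notin s -> ht u = 1%N /\ (pos u = 0%N \/ pos u = m).
    by move=> us; split; [apply: ht_eq1 us => v; exact: (proj1 branch_defect0P b0) | exact: ends].
  by case=> [[a1 a2]|[a1 a2]]; [left | right].
have [Hp HA] : (forall u, u \notin s -> ht u = 1%N /\ (pos u = 0%N \/ pos u = m)) /\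
    (#|A0| * #|A1| = #|B|./2 * uphalf #|B|)%N.
  by case: H => -[Hp -> ->]; split=> //; rewrite mulnC.
have ends u : u \notin s -> pos u = 0%N \/ pos u = m by case/Hp.
split; first by apply/branch_defect0P; exact: dist_pendent.
  exact/offpath_pos0P.
exact/ocE.
Qed.

End Position.
End TreeIdentities.

Theorem theorem4p1 (R : realType) (V : finType) (T : rel V) (v1 vc : V) (s : seq V)
  (wT wG : V -> R) (jT jG : V) :
  (4 <= #|V|)%N -> simple_graph T -> is_tree T ->
  v1 != vc -> ~~ T v1 vc -> path_between T v1 vc s ->
  stationary T wT -> stationary (add_edge T v1 vc) wG ->
  let n := #|V| in let c := size s in
  bound41 R n c <= kemeny (add_edge T v1 vc) wG jG - kemeny T wT jT /\
  (kemeny (add_edge T v1 vc) wG jG - kemeny T wT jT = bound41 R n c <->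
     pendent_at_ends T s v1 vc (n - c)./2 (uphalf (n - c)) \/
     pendent_at_ends T s v1 vc (uphalf (n - c)) (n - c)./2).
Proof.
move=> V4 [T_sym T_irr] [T_conn acyclic] xy nadj [t [-> tP yE tU]] sT sG n c.
subst vc; have [d dP] := exists_graph_distance T_conn.
have V1 : (1 < #|V|)%N by apply: leq_trans V4.
have t0 : (0 < size t)%N by case: (t) xy => //=; rewrite eqxx.
exact: (@kemeny_bound R V T T_sym T_irr T_conn acyclic d dP V1 v1 t tP tU xy nadj t0).
Qed.
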